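(* Let $f:(0,\infty)^2\to(0,\infty)$ be a symmetric real function that is increasing in the variable $x$. Let $c\geq 1$ and let $G$ be a graph with the smallest $\rho_f$ in $\mathcal{G}_{c,n}$. Then $G=\widehat{G}$.
   Context: All graphs are finite, simple and undirected. For a connected graph $G$ with vertices $v_1,\dots,v_n$ of degrees $d_1,\dots,d_n$, the $f$-adjacency matrix $A_f(G)$ has $(i,j)$-entry $f(d_i,d_j)$ if $v_iv_j\in E(G)$ and $0$ otherwise; $\rho_f(G)$ is the spectral radius of $A_f(G)$. ''Increasing in the variable $x$'' means non-decreasing in $x$ for each fixed $y$. $\mathcal{G}_{c,n}$ is the set of all connected graphs of order $n$ with cyclomatic number $c$ (i.e. $|E|-|V|+1=c$); its members are called $c$-cyclic graphs. The base $\widehat{G}$ of a $c$-cyclic graph $G$ is the unique minimal $c$-cyclic subgraph of $G$; it is obtained from $G$ by consecutively deleting pendant vertices (vertices of degree 1) until none remain. *)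

(* Defs.v *)
From HB Require Import structures.
From mathcomp Require Import all_boot all_order all_algebra.
From mathcomp Require Import complex.
From mathcomp Require Import boolp classical_sets reals.

Set Implicit Arguments.
Unset Strict Implicit.
Unset Printing Implicit Defensive.

Import Order.TTheory GRing.Theory Num.Theory.

Local Open Scope ring_scope.

(* Vertices form a subset of an ambient type, so that the subgraphs of a graph
   live in the same type as the graph itself. An edge is a 2-element set. *)
Record sgraph (T : finType) := SGraph {
  vertices : {set T};
  edges : {set {set T}};
  _ : [forall e in edges, (#|e| == 2) && (e \subset vertices)]
}.

Section Graphs.
Variable T : finType.
Implicit Types G H : sgraph T.

Definition adj G : rel T := [rel x y | [set x; y] \in edges G].

Definition degree G (x : T) : nat := #|[set y | adj G x y]|.

Definition graph_connected G : Prop :=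
  vertices G != finset.set0 /\
  {in vertices G &, forall x y, connect (adj G) x y}.

Definition cyclomatic G : int := #|edges G|%:Z - #|vertices G|%:Z + 1.

Definition cyclic (c : nat) G : Prop := graph_connected G /\ cyclomatic G = c%:Z.

Definition subgraph H G : Prop :=
  vertices H \subset vertices G /\ edges H \subset edges G.

(* H is a base of G when it is minimal, for inclusion, among the c-cyclic
   subgraphs of G. The base of G is the unique such H. *)
Definition is_base (c : nat) G H : Prop :=
  [/\ subgraph H G, cyclic c H &
      forall K, subgraph K H -> cyclic c K -> K = H].

End Graphs.

(* Graphs of order n are taken, up to isomorphism, with vertex set 'I_n. *)
Definition cyclic_graphs (c n : nat) (G : sgraph 'I_n) : Prop :=
  vertices G = [set: 'I_n]%SET /\ cyclic c G.

Section Spectrum.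
Variable R : realType.

Definition adjacency_mx n (f : R -> R -> R) (G : sgraph 'I_n) : 'M[R]_n :=
  \matrix_(i, j)
    if adj G i j then f (degree G i)%:R (degree G j)%:R else 0.

(* The set below is finite, and nonempty as soon as 0 < n, so that the
   supremum is then the largest modulus of a complex eigenvalue. *)
Definition spectral_radius n (A : 'M[R]_n) : R :=
  sup [set ComplexField.Normc.normc a | a in [set a : R[i] |
    eigenvalue (map_mx (real_complex R) A) a]]%classic.

Definition rho n (f : R -> R -> R) (G : sgraph 'I_n) : R :=
  spectral_radius (adjacency_mx f G).

End Spectrum.

(* Main.v *)
(** Perron vectors turn the comparison of spectral radii into the search for positive
    vectors [z] with [A_f(H) z <= r z], strictly at one vertex: pairing [z] with the Perron
    vector of the connected graph [H] gives [rho_f(H) < r].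

    Let [G] have a proper c-cyclic subgraph. Deleting pendant vertices from it leads to a c-cyclic
    subgraph [H] of minimum degree at least 2 that misses a vertex of [G]. As [f] is increasing,
    the Perron vector of [G] satisfies the above on [H] with [r = rho_f(G)], strictly at a vertex
    of [H] with a neighbour outside [H]. Now subdivide an edge at a vertex of [H] where [z] is
    minimal, and give the new vertex this minimal value: since all degrees are at least 2, the
    inequalities persist. Repeating this until all [n] vertices are used gives a c-cyclic graph
    of order [n] with spectral radius smaller than [rho_f(G)]. *)

Require Import Defs.
From mathcomp Require Import all_boot all_order all_algebra.
From mathcomp Require Import complex reals zify.

Set Implicit Arguments.
Unset Strict Implicit.
Unset Printing Implicit Defensive.

Import Order.TTheory GRing.Theory Num.Theory.
Local Open Scope ring_scope.

(** * Spectral radius of nonnegative symmetric matrices *)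

Lemma abs_eigenvector (C : numClosedFieldType) (n : nat) (B : 'M[C]_n) (u : 'rV_n) (a : C) :
  B^T = B -> (forall i j, 0 <= B i j) -> u *m B = a *: u ->
  (forall b, eigenvalue B b -> `|b| <= `|a|) ->
  map_mx Num.norm u *m B = `|a| *: map_mx Num.norm u.
Proof.
(* [w = |u|] satisfies [|a| w <= w B] entrywise, so [|a| I - B], which is positive semidefinite
   because [B] is unitarily diagonalizable, has a nonpositive quadratic form at [w]. *)
move=> symB B_ge0 uB a_max; set w := map_mx _ u.
have realB : B \is a mxOver Num.real by apply/mxOverP => i j; rewrite ger0_real.
have hermB : B \is hermsymmx.
  by apply: realsym_hermsym => //; apply/is_hermitianmxP; rewrite scale1r map_mx_id ?symB.
have Bdiag := orthomx_spectralP (hermitian_normalmx hermB).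
set P := spectralmx B in Bdiag; set d := spectral_diag B in Bdiag.
have unitP : P \in unitmx by exact: spectral_unit.
have PV : invmx P = map_mx Num.Def.conjC P^T by apply/invmx_unitary/spectral_unitarymx.
have d_real i : d 0 i \is Num.real.
  by have /mxOverP/(_ 0 i) := hermitian_spectral_diag_real hermB.
have d_le i : d 0 i <= `|a|.
  apply: le_trans (real_ler_norm (d_real i)) _; apply: a_max.
  (* The rows of [P] form an eigenbasis of [B]; row [i] belongs to [d 0 i]. *)
  apply/eigenvalueP; exists (row i P).
    rewrite -row_mul [in LHS]Bdiag !mulmxA mulmxV // mul1mx.
    by rewrite row_mul row_diag_mx -scalemxAl -rowE.
  rewrite rowE mulmx_free_eq0 ?row_free_unit //.
  by apply/eqP => /rowP/(_ i)/eqP; rewrite !mxE !eqxx oner_eq0.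
pose y := w *m invmx P.
have wE : w = y *m P by rewrite mulmxKV.
pose adj m k (M : 'M[C]_(m, k)) := map_mx Num.Def.conjC M^T.
have quad (D : 'rV_n) : (y *m diag_mx D *m adj _ _ y) 0 0 = \sum_i D 0 i * `|y 0 i| ^+ 2.
  rewrite mul_mx_diag mxE; apply: eq_bigr => i _.
  by rewrite !mxE normCK mulrAC mulrC.
have adjwE : adj _ _ w = invmx P *m adj _ _ y.
  by rewrite {1}wE PV /adj trmx_mul map_mxM.
have wBw : (w *m B *m adj _ _ w) 0 0 = \sum_i d 0 i * `|y 0 i| ^+ 2.
  by rewrite -quad {1}wE Bdiag adjwE !mulmxA !mulmxK.
have ww : (w *m adj _ _ w) 0 0 = \sum_i `|y 0 i| ^+ 2.
  rewrite {1}wE adjwE !mulmxA mulmxK //; have := quad (const_mx 1).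
  rewrite diag_const_mx mulmx1 => ->; by apply: eq_bigr => i _; rewrite mxE mul1r.
have wB_ge i : `|a| * w 0 i <= (w *m B) 0 i.
  have /rowP/(_ i) := uB; rewrite !mxE => /esym uBi.
  rewrite -normrM uBi; apply: le_trans (ler_norm_sum _ _ _) _.
  by apply: ler_sum => j _; rewrite mxE normrM (ger0_norm (B_ge0 _ _)).
have term_ge0 i : 0 <= (`|a| - d 0 i) * `|y 0 i| ^+ 2.
  by rewrite mulr_ge0 ?subr_ge0 // exprn_ge0.
have sum_le0 : \sum_i (`|a| - d 0 i) * `|y 0 i| ^+ 2 <= 0.
  under eq_bigr do rewrite mulrBl.
  rewrite sumrB -mulr_sumr -ww -wBw subr_le0 ![(_ *m adj _ _ w) 0 0]mxE mulr_sumr.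
  apply: ler_sum => i _; rewrite mulrA; apply: ler_wpM2r (wB_ge i).
  by rewrite !mxE geC0_conj normr_ge0.
(* A nonpositive sum of nonnegative terms has only zero terms, so [y] is supported where [d 0 i]
   equals [|a|]. *)
have yd i : y 0 i * d 0 i = `|a| * y 0 i.
  have /eqP : \sum_i (`|a| - d 0 i) * `|y 0 i| ^+ 2 = 0.
    by apply/le_anti; rewrite sum_le0 sumr_ge0.
  rewrite psumr_eq0 // => /allP/(_ i (mem_index_enum _)).
  rewrite mulf_eq0 expf_eq0 /= normr_eq0 subr_eq0 => /orP[] /eqP; first by move->; rewrite mulrC.
  by move->; rewrite mulr0 mul0r.
rewrite {1}wE Bdiag !mulmxA mulmxK // wE scalemxAl; congr (_ *m P).
by apply/rowP => i; rewrite mul_mx_diag mxE yd [RHS]mxE.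
Qed.

(** The characteristic polynomial splits over [R[i]], so the eigenvalues form a finite nonempty list
    and the supremum is attained. *)
Lemma spectral_radiusP (R : realType) (n : nat) (A : 'M[R]_n) : (0 < n)%N ->
  let AC := map_mx (real_complex R) A in
  exists a : R[i], [/\ eigenvalue AC a, `|a| = (spectral_radius A)%:C%C &
    forall b, eigenvalue AC b -> `|b| <= `|a|].
Proof.
move=> n_gt0 AC; have [rs char_rs] := closed_field_poly_normal (char_poly AC).
have eigE b : eigenvalue AC b = (b \in rs).
  rewrite eigenvalue_root_char char_rs (monicP (char_poly_monic _)) scale1r.
  by rewrite root_prod_XsubC.
have [a0 a0_rs] : exists a0, a0 \in rs.
  by have [a0] := eigenvalue_closed AC n_gt0; rewrite eigE; exists a0.
(* Moduli are taken in [R], because the maximum is sought in a total order. *)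
pose h (b : seq_sub rs) : R := ComplexField.Normc.normc (ssval b).
have [i _ i_max] := @Order.TotalTheory.arg_maxP _ _ _ (SeqSub a0_rs) predT h isT.
have a_max b : eigenvalue AC b -> ComplexField.Normc.normc b <= h i.
  by rewrite eigE => b_rs; apply: (i_max (SeqSub b_rs)).
have a_eig : eigenvalue AC (ssval i) by rewrite eigE ssvalP.
exists (ssval i); split => // [|b /a_max]; last by rewrite -lecR.
congr (_%:C)%C; apply/le_anti/andP; split.
  apply: ub_le_sup; first by exists (h i) => _ [b /= /a_max hb <-].
  by exists (ssval i).
by apply: ge_sup => [|_ [b /= /a_max hb <-] //]; exists (h i), (ssval i).
Qed.

(** The entrywise moduli of an eigenvector for an eigenvalue of largest modulus again form an
    eigenvector. Positivity everywhere is left to [perron_vector], where connectedness is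
    available. *)
Lemma nonneg_symmetric_eigenvector (R : realType) (n : nat) (A : 'M[R]_n) :
  (0 < n)%N -> A^T = A -> (forall i j, 0 <= A i j) ->
  exists y : 'I_n -> R, [/\ forall i, 0 <= y i, exists i, y i != 0 &
    forall i, \sum_j A i j * y j = spectral_radius A * y i].
Proof.
move=> n_gt0 symA A_ge0.
have [a [/eigenvalueP[u uA u_neq0] a_rho a_max]] := spectral_radiusP A n_gt0.
have symAC : (map_mx (real_complex R) A)^T = map_mx (real_complex R) A by rewrite map_trmx symA.
have AC_ge0 i j : 0 <= map_mx (real_complex R) A i j by rewrite mxE (lecR 0).
have absu := abs_eigenvector symAC AC_ge0 uA a_max.
exists (fun i => ComplexField.Normc.normc (u 0 i)); split => [i||i].
- by rewrite -lecR; exact: (normr_ge0 (u 0 i)).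
- have [i ui_neq0] := rV0Pn _ u_neq0.
  by exists i; apply: contra_neq ui_neq0 => /ComplexField.Normc.eq0_normc.
apply: (@complexI R); rewrite rmorph_sum rmorphM /= -a_rho.
have /rowP/(_ i) := absu; rewrite !mxE => <-; apply: eq_bigr => j _.
by rewrite !mxE rmorphM /= mulrC -[A in RHS]symA mxE.
Qed.

(** * Cyclomatic number, connectedness and deletion of pendant vertices *)

Section GraphTheory.
Variable T : finType.
Implicit Types (G H K : sgraph T) (x y u v w : T).

Lemma sgraph_eq G H : vertices G = vertices H -> edges G = edges H -> G = H.
Proof.
case: G H => [V E h] [V' E' h'] /= eV eE; case: V' / eV h' => h'; case: E' / eE h' => h'.
by rewrite (bool_irrelevance h h').
Qed.

Lemma eq_set2 x y u v :
  ([set x; y] == [set u; v]) = (x == u) && (y == v) || (x == v) && (y == u).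
Proof.
apply/eqP/idP => [/setP e|/orP[] /andP[/eqP-> /eqP->] //]; last by rewrite setUC.
move: (e x) (e y) (e u) (e v); rewrite !inE !eqxx /= !orbT ![u == _]eq_sym ![v == _]eq_sym.
by case: (x == u) (x == v) (y == u) (y == v) => [] [] [] [].
Qed.

Lemma edge_card G e : e \in edges G -> #|e| = 2.
Proof. by case: G => V E /= /forallP/(_ e)/implyP h /h /andP[/eqP]. Qed.

Lemma edge_sub G e : e \in edges G -> e \subset vertices G.
Proof. by case: G => V E /= /forallP/(_ e)/implyP h /h /andP[]. Qed.

Lemma adjE G x y : adj G x y = ([set x; y] \in edges G).
Proof. by []. Qed.

Lemma adjC G x y : adj G x y = adj G y x.
Proof. by rewrite /adj /= setUC. Qed.

Lemma adjxx G x : adj G x x = false.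
Proof. by apply/negP => /edge_card; rewrite setUid cards1. Qed.

Lemma adj_vertex G x y : adj G x y -> x \in vertices G.
Proof. by move=> /edge_sub /subsetP; apply; rewrite !inE eqxx. Qed.

Lemma degree_gt0 G x y : adj G x y -> (0 < degree G x)%N.
Proof. by move=> xy; apply/card_gt0P; exists y; rewrite inE. Qed.

Lemma adj_sub G H x y : subgraph H G -> adj H x y -> adj G x y.
Proof. by case=> _ /subsetP; apply. Qed.

Lemma degree_sub G H x : subgraph H G -> (degree H x <= degree G x)%N.
Proof. by move=> HG; apply/subset_leq_card/subsetP => y; rewrite !inE; apply: adj_sub. Qed.

Lemma cyclomaticP c G : cyclomatic G = c%:Z <-> #|edges G|.+1 = (#|vertices G| + c)%N.
Proof. by rewrite /cyclomatic; move: #|edges G| #|vertices G| => m n; lia. Qed.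

(** The vertex set and the cyclomatic number determine the number of edges, so one edge set included
    in the other must equal it. *)
Lemma cyclic_spanning_eq c G H : subgraph H G -> cyclic c G -> cyclic c H ->
  vertices H = vertices G -> H = G.
Proof.
move=> [_ sE] [_ cG] [_ cH] eV; apply: sgraph_eq => //; apply/eqP; rewrite eqEcard sE /=.
by move/cyclomaticP: cG; move/cyclomaticP: cH; rewrite eV => <- /eqP; rewrite eqSS => /eqP ->.
Qed.

Lemma connect_crossing (e : rel T) (S : pred T) x y :
  connect e x y -> x \in S -> y \notin S -> exists a b, [/\ a \in S, b \notin S & e a b].
Proof.
move=> /connectP[p]; elim: p x => [|z p IHp] x /= => [_ -> -> //|/andP[xz zp] ylast xS yS].
by have [zS|zS] := boolP (z \in S); [apply: IHp zp _ zS yS|exists x, z].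
Qed.

(** One vertex and one edge disappear, which keeps [|E| - |V|]. *)
Lemma delete_pendant c G x : cyclic c G -> x \in vertices G -> degree G x = 1 ->
  exists H, [/\ subgraph H G, cyclic c H & vertices H = vertices G :\ x].
Proof.
move=> [[_ connG] cG] xV /eqP/cards1P[u Nx].
have xN y : adj G x y = (y == u) by move/setP/(_ y): Nx; rewrite !inE.
have xu : adj G x u by rewrite xN.
have uV : u \in vertices G by rewrite adjC in xu; exact: adj_vertex xu.
have ux : u != x by apply: contraTneq xu => ->; rewrite adjxx.
have HE : [forall e in edges G :\ [set x; u], (#|e| == 2) && (e \subset vertices G :\ x)].
  apply/forallP => e; apply/implyP; rewrite !inE => /andP[exu eE].
  rewrite (edge_card eE) eqxx subsetD1 (edge_sub eE) /=.
  (* As [u] is the single neighbour of [x], the only edge containing [x] is the deleted one. *)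
  apply: contra exu => xe; have /eqP/cards2P[a [b [ab eab]]] := edge_card eE.
  move: xe eE; rewrite {e}eab !inE => /orP[] /eqP <- h.
    by move: h; rewrite -adjE xN => /eqP->.
  by move: h; rewrite setUC -adjE xN => /eqP->.
exists (SGraph HE); split => //; first by split; exact: subD1set.
split; first split.
- by apply/set0Pn; exists u; rewrite !inE ux.
(* The retraction [phi] folds [x] onto [u]: it sends an edge of [G] to an edge of the new graph or
   to a single vertex, so paths of [G] through [x] still give connections. *)
- pose phi y := if y == x then u else y.
  have step a b : adj G a b -> connect (adj (SGraph HE)) (phi a) (phi b).
    move=> ab; rewrite /phi; have [ax|ax] := eqVneq a x; have [bx|bx] := eqVneq b x => //.
    + by move: ab; rewrite ax xN => /eqP->.
    + by move: ab; rewrite bx adjC xN => /eqP->.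
    apply: connect1; rewrite /adj /= !inE -adjE ab andbT eq_set2 (negPf ax) (negPf bx).
    by rewrite andbF.
  move=> a b; rewrite !inE => /andP[ax aV] /andP[bx bV].
  have /connectP[p] := connG a b aV bV.
  have -> : a = phi a by rewrite /phi (negPf ax).
  have eb : b = phi b by rewrite /phi (negPf bx).
  rewrite {2}eb; have -> : path (adj G) (phi a) p = path (adj G) a p by rewrite /phi (negPf ax).
  have -> : last (phi a) p = last a p by rewrite /phi (negPf ax).
  move=> + -> {ax aV bx bV b eb}; elim: p a => [|z p IHp] a //= /andP[az zp].
  exact: connect_trans (step _ _ az) (IHp _ zp).
apply/cyclomaticP; move/cyclomaticP: cG; rewrite (cardsD1 x (vertices G)) xV.
by rewrite (cardsD1 [set x; u] (edges G)) -adjE xu !add1n addSn => -[].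
Qed.

(** In a connected graph an isolated vertex is the only vertex; then there is no edge and the
    cyclomatic number is 0. *)
Lemma degree_neq0 c G x : (0 < c)%N -> cyclic c G -> x \in vertices G -> degree G x != 0%N.
Proof.
move=> c_gt0 [[_ connG] cG] xV; apply: contraTneq c_gt0 => dx0.
have iso y : adj G x y = false by apply: contra_eqF dx0 => /degree_gt0; rewrite lt0n.
have eV : vertices G = [set x].
  apply/eqP; rewrite eqEsubset sub1set xV andbT; apply/subsetP => y yV.
  rewrite inE; apply: contraT => yx.
  have [a [b []]] := @connect_crossing _ (pred1 x) _ _ (connG x y xV yV) (eqxx x) yx.
  by rewrite inE => /eqP-> _; rewrite iso.
have eE : edges G = set0.
  apply/eqP/negPn/negP => /set0Pn[e eE].
  by have := subset_leq_card (edge_sub eE); rewrite (edge_card eE) eV cards1.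
by move/cyclomaticP: cG; rewrite eV eE cards1 cards0 add1n => -[<-].
Qed.

(** Pendant vertices are deleted by induction on the number of vertices. Since [degree_neq0]
    excludes degree 0, a vertex of degree below 2 is pendant. *)
Lemma cyclic_core c G : (0 < c)%N -> cyclic c G ->
  exists H, [/\ subgraph H G, cyclic c H & {in vertices H, forall x, (1 < degree H x)%N}].
Proof.
move=> c_gt0; have [m] := ubnP #|vertices G|; elim: m G => // m IHm G Vm cG.
have [/forall_inP deg2|] := boolP [forall x in vertices G, 1 < degree G x]%N.
  by exists G; split => //; split.
rewrite negb_forall_in => /exists_inP[x xV]; rewrite -leqNgt leq_eqVlt ltnS leqn0.
rewrite (negPf (degree_neq0 c_gt0 cG xV)) orbF => /eqP dx.
have [H [[HV HE] cH VH]] := delete_pendant cG xV dx.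
have [|K [[KV KE] cK degK]] := IHm H _ cH.
  by move: Vm; rewrite VH (cardsD1 x (vertices G)) xV; lia.
by exists K; split => //; split; [exact: subset_trans HV|exact: subset_trans HE].
Qed.

(** * Subdivision of an edge *)

Lemma subdivide_edge G v u w : adj G v u -> w \notin vertices G ->
  exists K, vertices K = w |: vertices G /\
            edges K = [set v; w] |: ([set w; u] |: edges G :\ [set v; u]).
Proof.
move=> vu wV; have vV := adj_vertex vu.
have uV : u \in vertices G by rewrite adjC in vu; apply: adj_vertex vu.
have KE : [forall e in [set v; w] |: ([set w; u] |: edges G :\ [set v; u]),
             (#|e| == 2) && (e \subset w |: vertices G)].
  apply/forallP => e; apply/implyP; rewrite !inE => /or3P[/eqP->|/eqP->|/andP[_ eE]].
  - rewrite cards2 subUset !sub1set !inE vV eqxx orbT (contraNneq _ wV) // => <-; exact: vV.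
  - rewrite cards2 subUset !sub1set !inE uV eqxx orbT (contraNneq _ wV) // => ->; exact: uV.
  by rewrite (edge_card eE) eqxx (subset_trans (edge_sub eE)) // subsetUr.
by exists (SGraph KE).
Qed.

Section Subdivision.
Variables (G K : sgraph T) (v u w : T).
Hypotheses (vu : adj G v u) (wV : w \notin vertices G).
Hypotheses (VK : vertices K = w |: vertices G)
  (EK : edges K = [set v; w] |: ([set w; u] |: edges G :\ [set v; u])).

Let wN x : adj G w x = false.
Proof. by apply: contraNF wV => /adj_vertex. Qed.

Let vw : v != w. Proof. by apply: contraTneq vu => ->; rewrite wN. Qed.
Let uw : u != w. Proof. by apply: contraTneq vu => ->; rewrite adjC wN. Qed.
Let uv : u != v. Proof. by apply: contraTneq vu => ->; rewrite adjxx. Qed.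

Let adjK x y : adj K x y = [|| (x == v) && (y == w) || (x == w) && (y == v),
  (x == w) && (y == u) || (x == u) && (y == w) |
  ~~ ((x == v) && (y == u) || (x == u) && (y == v)) && adj G x y].
Proof. by rewrite /adj /= EK !inE !eq_set2. Qed.

Lemma subdivide_adj_w y : adj K w y = (y == v) || (y == u).
Proof. by rewrite adjK eqxx wN andbF orbF ![w == _]eq_sym (negPf vw) (negPf uw) /= !orbF. Qed.

Lemma subdivide_adj_l y : adj K v y = (y == w) || (y != u) && adj G v y.
Proof. by rewrite adjK eqxx (negPf vw) ![v == _]eq_sym (negPf uv) /= !orbF. Qed.

Lemma subdivide_adj_r y : adj K u y = (y == w) || (y != v) && adj G u y.
Proof. by rewrite adjK eqxx (negPf uw) (negPf uv) /=. Qed.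

Lemma subdivide_adj x y : x != v -> x != u -> x != w -> adj K x y = adj G x y.
Proof. by move=> /negPf xv /negPf xu /negPf xw; rewrite adjK xv xu xw. Qed.

Lemma subdivide_degree_w : degree K w = 2.
Proof.
have -> : degree K w = #|[set v; u]| by apply: eq_card => y; rewrite !inE subdivide_adj_w.
by rewrite cards2 eq_sym uv.
Qed.

(** Each end of the subdivided edge trades one neighbour for [w]; every other old vertex keeps its
    neighbourhood. *)
Lemma subdivide_degree x : x != w -> degree K x = degree G x.
Proof.
have swap a b : a != w -> adj G a b -> (forall y, adj K a y = (y == w) || (y != b) && adj G a y) ->
    degree K a = degree G a.
  move=> aw ab aN; rewrite /degree (cardsD1 b [set y | adj G a y]) inE ab.
  rewrite (cardsD1 w [set y | adj K a y]) inE aN eqxx; congr (_ + _)%N.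
  apply: eq_card => y; rewrite !inE aN; have [->|//] := eqVneq y w.
  by rewrite [adj G a w]adjC wN andbF.
move=> xw; have [xv|xv] := eqVneq x v; first by rewrite xv; apply: swap vu subdivide_adj_l.
have [xu|xu] := eqVneq x u; first by rewrite xu; apply: swap subdivide_adj_r => //; rewrite adjC.
by apply: eq_card => y; rewrite !inE subdivide_adj.
Qed.

(** Vertices and edges both increase by one, and the removed edge [vu] is bypassed through [w]. *)
Lemma subdivide_cyclic c : cyclic c G -> cyclic c K.
Proof.
move=> [[_ connG] cG]; have vV := adj_vertex vu.
have symK : connect_sym (adj K) by apply: sym_connect_sym => x y; rewrite adjC.
have wv : adj K w v by rewrite subdivide_adj_w eqxx.
have vuK : connect (adj K) v u.
  apply: (@connect_trans _ _ w); first by rewrite symK connect1.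
  by rewrite connect1 // subdivide_adj_w eqxx orbT.
have sub x y : adj G x y -> connect (adj K) x y.
  move=> xy; have [/orP[] /andP[/eqP-> /eqP->] //|nvu] :=
    boolP ((x == v) && (y == u) || (x == u) && (y == v)); first by rewrite symK.
  by apply: connect1; rewrite adjK nvu xy !orbT.
have connv x : x \in vertices K -> connect (adj K) x v.
  rewrite VK !inE => /orP[/eqP->|xV]; first exact: connect1.
  exact: (connect_sub sub) (connG x v xV vV).
split; first split.
- by apply/set0Pn; exists w; rewrite VK !inE eqxx.
- by move=> x y xK yK; apply: connect_trans (connv x xK) _; rewrite symK connv.
have vwE : [set v; w] \notin edges G by rewrite -adjE adjC wN.
have wuE : [set w; u] \notin edges G by rewrite -adjE wN.
apply/cyclomaticP; move/cyclomaticP: cG.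
rewrite VK EK !cardsU1 !inE wV (negPf vwE) (negPf wuE) !andbF !orbF.
rewrite (cardsD1 [set v; u] (edges G)) -adjE vu eq_set2 (negPf vw) [v == u]eq_sym (negPf uv) /=.
by rewrite !add1n !addSn => ->.
Qed.

End Subdivision.
End GraphTheory.

(** * Perron vectors and comparison of spectral radii *)

Section WeightedAdjacency.
Variables (R : realType) (f : R -> R -> R).
Hypothesis f_gt0 : forall x y : R, 0 < x -> 0 < y -> 0 < f x y.
Hypothesis f_sym : forall x y : R, 0 < x -> 0 < y -> f x y = f y x.
Hypothesis f_incr : forall x1 x2 y : R, 0 < x1 -> 0 < y -> x1 <= x2 -> f x1 y <= f x2 y.

Let weight_gt0 (a b : nat) : (0 < a)%N -> (0 < b)%N -> 0 < f a%:R b%:R.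
Proof. by move=> a0 b0; rewrite f_gt0 ?ltr0n. Qed.

Let weight_sym (a b : nat) : (0 < a)%N -> (0 < b)%N -> f a%:R b%:R = f b%:R a%:R.
Proof. by move=> a0 b0; rewrite f_sym ?ltr0n. Qed.

Let weight_le (a b a' b' : nat) : (0 < a)%N -> (0 < b)%N -> (a <= a')%N -> (b <= b')%N ->
  f a%:R b%:R <= f a'%:R b'%:R.
Proof.
move=> a0 b0 aa bb; have a'0 := leq_trans a0 aa; have b'0 := leq_trans b0 bb.
apply: (@le_trans _ _ (f a'%:R b%:R)); first by rewrite f_incr ?ltr0n ?ler_nat.
(* Monotonicity in the second variable follows from the first by symmetry. *)
by rewrite (weight_sym a'0 b0) (weight_sym a'0 b'0) f_incr ?ltr0n ?ler_nat.
Qed.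

(** The entry at [x] of [A_f(G) z]. It makes sense over any ambient type, so graphs that miss some
    vertices are covered. *)
Definition adj_sum (T : finType) (G : sgraph T) (z : T -> R) (x : T) : R :=
  \sum_(y | adj G x y) f (degree G x)%:R (degree G y)%:R * z y.

Lemma adj_sum_mx n (G : sgraph 'I_n) z i :
  adj_sum G z i = \sum_j adjacency_mx f G i j * z j.
Proof.
rewrite /adj_sum big_mkcond; apply: eq_bigr => j _; rewrite mxE.
by case: ifP; rewrite ?mul0r.
Qed.

Lemma adjacency_mx_ge0 n (G : sgraph 'I_n) i j : 0 <= adjacency_mx f G i j.
Proof.
rewrite mxE; case: ifP => // ij; apply/ltW/weight_gt0; first exact: degree_gt0 ij.
by rewrite adjC in ij; exact: degree_gt0 ij.
Qed.

Lemma adjacency_mx_sym n (G : sgraph 'I_n) : (adjacency_mx f G)^T = adjacency_mx f G.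
Proof.
apply/matrixP => i j; rewrite !mxE adjC; case: ifP => // ij.
by rewrite weight_sym //; [rewrite adjC in ij|]; exact: degree_gt0 ij.
Qed.

(** Zeros of a nonnegative eigenvector spread: the equation at a zero forces zeros at all
    neighbours, so connectedness would make the vector vanish identically. *)
Lemma perron_vector n (G : sgraph 'I_n) : graph_connected G -> vertices G = setT ->
  exists2 y : 'I_n -> R, forall i, 0 < y i & forall i, adj_sum G y i = rho f G * y i.
Proof.
move=> [/set0Pn[i0 _] connG] VG.
have n_gt0 : (0 < n)%N by apply: leq_ltn_trans (ltn_ord i0).
have [y [y_ge0 [i1 yi1] yA]] :=
  nonneg_symmetric_eigenvector n_gt0 (adjacency_mx_sym G) (adjacency_mx_ge0 G).
exists y => [i|i]; last by rewrite adj_sum_mx yA.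
rewrite lt0r y_ge0 andbT; apply/negP => yi.
have := connG i1 i; rewrite VG !inE => /(_ isT isT) conn.
have [||a [b [ya yb ab]]] := @connect_crossing _ _ (fun j => y j != 0) _ _ conn;
  rewrite ?unfold_in ?yi //.
move: ya yb; rewrite !unfold_in negbK => ya /eqP yb.
have /eqP := yA b; rewrite yb mulr0 psumr_eq0 => [|j _]; last by rewrite mulr_ge0 ?adjacency_mx_ge0.
move/allP/(_ a (mem_index_enum _)); rewrite mulf_eq0 (negPf ya) orbF mxE adjC ab.
by rewrite gt_eqF // weight_gt0 ?(degree_gt0 ab) //; rewrite adjC in ab; exact: degree_gt0 ab.
Qed.

(** With [y] the Perron vector, symmetry of the matrix gives [rho <y, z> = <A y, z> = <y, A z> < r
    <y, z>]; one strict vertex suffices because [y] is positive there. *)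
Lemma rho_lt n (G : sgraph 'I_n) (z : 'I_n -> R) (r : R) :
  graph_connected G -> vertices G = setT -> (forall i, 0 < z i) ->
  (forall i, adj_sum G z i <= r * z i) -> (exists i, adj_sum G z i < r * z i) ->
  rho f G < r.
Proof.
move=> connG VG z_gt0 z_le [s z_lt]; have [y y_gt0 yA] := perron_vector connG VG.
have yz_gt0 : 0 < \sum_i y i * z i.
  rewrite (bigD1 s) //= ltr_wpDr ?mulr_gt0 //.
  by apply: sumr_ge0 => i _; rewrite ltW ?mulr_gt0.
rewrite -(ltr_pM2r yz_gt0) !mulr_sumr.
under eq_bigr do rewrite mulrA -yA adj_sum_mx mulr_suml.
rewrite exchange_big /=.
have eqA j : \sum_i adjacency_mx f G i j * y j * z i = y j * adj_sum G z j.
  rewrite adj_sum_mx mulr_sumr; apply: eq_bigr => i _.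
  by rewrite -[in LHS]adjacency_mx_sym mxE mulrCA mulrA.
under eq_bigr do rewrite eqA.
rewrite (bigD1 s) // [ltRHS](bigD1 s) //= ltr_leD //.
  by rewrite mulrCA ltr_pM2l.
by apply: ler_sum => i _; rewrite mulrCA ler_pM2l.
Qed.

(** * Supersolutions under subdivision and on subgraphs *)

Definition min_degree2 (T : finType) (G : sgraph T) :=
  {in vertices G, forall x, (1 < degree G x)%N}.

(** A Collatz-Wielandt certificate: by [rho_lt], on a connected graph using all vertices it gives
    [rho f G < r]. *)
Definition strict_supersolution (T : finType) (G : sgraph T) (r : R) (z : T -> R) :=
  [/\ forall x, 0 < z x, {in vertices G, forall x, adj_sum G z x <= r * z x} &
      exists2 x, x \in vertices G & adj_sum G z x < r * z x].

(** The new vertex has degree 2, the least degree present, and the least value [z v], so putting it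
    in place of an end of [vu] raises no sum at the old vertices. *)
Lemma subdivide_supersolution (T : finType) (G : sgraph T) c r z w :
  cyclic c G -> min_degree2 G -> strict_supersolution G r z -> w \notin vertices G ->
  exists (K : sgraph T) (z' : T -> R), [/\ vertices K = w |: vertices G, cyclic c K, min_degree2 K &
                   strict_supersolution K r z'].
Proof.
move=> cG deg2 [z_gt0 z_le [s sV z_lt]] wV; have [[/set0Pn[x0 x0V] _] _] := cG.
have [v vV v_min] := arg_minP z x0V.
(* The edge to subdivide is [vu]; the second neighbour [t] of [v] enters the inequality at [w]. *)
have /card_gt1P[u [t []]] := deg2 v vV; rewrite !inE => vu vt ut.
have adjV x y : adj G x y -> y \in vertices G by rewrite adjC; exact: adj_vertex.
have uV := adjV _ _ vu; have tV := adjV _ _ vt.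
have neq_w x : x \in vertices G -> x != w by move=> xV; apply: contraNneq wV => <-.
have [K [VK EK]] := subdivide_edge vu wV.
have degw := subdivide_degree_w vu wV EK.
have deg x : x \in vertices G -> degree K x = degree G x.
  by move=> /neq_w; exact: subdivide_degree vu wV EK x.
pose z' x := if x == w then z v else z x.
have z'w : z' w = z v by rewrite /z' eqxx.
have z'E x : x \in vertices G -> z' x = z x by move=> /neq_w/negPf xw; rewrite /z' xw.
pose g (a b : nat) : R := f a%:R b%:R.
pose d := degree G.
have dpos x : x \in vertices G -> (0 < d x)%N by move=> /deg2 /ltnW.
have rest (P : pred T) x : x \in vertices G -> (forall y, P y -> y \in vertices G) ->
    \sum_(y | P y) g (degree K x) (degree K y) * z' y = \sum_(y | P y) g (d x) (d y) * z y.
  by move=> xV PV; apply: eq_bigr => y /PV yV; rewrite !deg ?z'E.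
(* At an end [a] of the edge, [w] replaces the other end [b], and only this term changes. *)
have swap a b : a \in vertices G -> adj G a b ->
    (forall y, adj K a y = (y == w) || (y != b) && adj G a y) ->
    g (d a) 2 * z v <= g (d a) (d b) * z b -> adj_sum K z' a <= adj_sum G z a.
  move=> aV ab adjKa le_ab; rewrite /adj_sum (bigD1 w) /= ?adjKa ?eqxx // [leRHS](bigD1 b) //=.
  rewrite degw z'w lerD //; first by rewrite deg.
  rewrite (eq_bigl (fun y => adj G a y && (y != b))) => [|y]; last first.
    rewrite adjKa; have [->|//] := eqVneq y w; last by rewrite andbT andbC.
    by rewrite andbF; apply/esym/negbTE; rewrite negb_and (contra _ wV) //; exact: adjV.
  rewrite rest // => y /andP[ay _]; exact: adjV ay.
have sum_le x : x \in vertices G -> adj_sum K z' x <= adj_sum G z x.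
  move=> xV; have [->|xv] := eqVneq x v.
    apply: (swap v u vV vu); first exact: subdivide_adj_l vu wV EK.
    apply: ler_pM; [by rewrite ltW ?weight_gt0 ?dpos|exact: ltW| |exact: v_min].
    by apply: weight_le; rewrite ?dpos ?deg2.
  have [->|xu] := eqVneq x u.
    apply: (swap u v uV); rewrite 1?adjC //; first exact: subdivide_adj_r vu wV EK.
    by rewrite ler_pM2r // weight_le ?dpos ?deg2.
  rewrite /adj_sum (eq_bigl (adj G x)) => [|y]; last first.
    by rewrite (subdivide_adj EK) ?neq_w.
  by rewrite -!/(g _ _) rest // => y; exact: adjV.
exists K, z'; split => //.
- exact: subdivide_cyclic vu wV VK EK c cG.
- by move=> x; rewrite VK !inE => /orP[/eqP->|xV]; rewrite ?degw ?deg ?deg2.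
split => [x|x|]; first by rewrite /z'; case: ifP.
- rewrite VK !inE => /orP[/eqP->|xV]; last by rewrite z'E // (le_trans (sum_le x xV)) ?z_le.
  (* The sum at [w] is compared with that of [G] at [v]: its term for [v] is at most the term for
     [t], its term for [u] at most the term for [u], and the other neighbours of [v] contribute at
     least 0. *)
  rewrite z'w; apply: le_trans (z_le v vV).
  rewrite /adj_sum (eq_bigl (mem [set v; u])) => [|y]; last first.
    by rewrite (subdivide_adj_w vu wV EK) !inE.
  have uv : u != v by apply: contraTneq vu => ->; rewrite adjxx.
  rewrite big_setU1 ?inE 1?eq_sym //= big_set1 degw !deg // !z'E //.
  rewrite (bigD1 u) //= (bigD1 t) /=; last by rewrite vt eq_sym.
  rewrite addrA -[leLHS]addr0; apply: lerD; last first.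
    apply: sumr_ge0 => y /andP[/andP[vy _] _].
    by rewrite ltW // mulr_gt0 // weight_gt0 ?dpos //; exact: adjV vy.
  rewrite [leRHS]addrC; apply: lerD.
    rewrite weight_sym ?dpos //.
    apply: ler_pM; [by rewrite ltW ?weight_gt0 ?dpos|exact: ltW| |exact: v_min].
    by apply: weight_le; rewrite ?dpos ?deg2.
  by rewrite ler_pM2r // weight_le ?dpos ?deg2.
exists s; first by rewrite VK !inE sV orbT.
by rewrite z'E // (le_lt_trans (sum_le s sV)).
Qed.

(** Induction on the number of vertices not yet used, with one subdivision for each. *)
Lemma spanning_supersolution (T : finType) (G : sgraph T) c r z :
  cyclic c G -> min_degree2 G -> strict_supersolution G r z ->
  exists (K : sgraph T) (z' : T -> R), [/\ vertices K = setT, cyclic c K &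
    strict_supersolution K r z'].
Proof.
have [m] := ubnP #|~: vertices G|; elim: m G z => // m IHm G z Vm cG deg2 zG.
have [VG|/set0Pn[w]] := eqVneq (~: vertices G) set0.
  by exists G, z; split => //; rewrite -[LHS]setCK VG setC0.
rewrite inE => wV; have [K [z' [VK cK deg2K zK]]] := subdivide_supersolution cG deg2 zG wV.
apply: (IHm K z') => //; move: Vm; rewrite (cardsD1 w) inE wV add1n !ltnS; apply: leq_trans.
by rewrite VK setCU setIC -setDE.
Qed.

(** Passing to [H] lowers degrees and removes neighbours, so no sum grows. Connectedness gives an
    edge from [H] to a vertex outside; the loss of its positive term makes the inequality strict. *)
Lemma subgraph_supersolution (T : finType) (G H : sgraph T) r z :
  subgraph H G -> vertices H != vertices G -> vertices H != set0 -> graph_connected G ->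
  (forall x, 0 < z x) -> (forall x, adj_sum G z x = r * z x) -> strict_supersolution H r z.
Proof.
move=> HG VHG /set0Pn[x xH] [_ connG] z_gt0 zG; have [VHs _] := HG.
have term_ge0 a b : adj G a b -> 0 < f (degree G a)%:R (degree G b)%:R * z b.
  move=> ab; rewrite mulr_gt0 // weight_gt0 ?(degree_gt0 ab) //.
  by rewrite adjC in ab; exact: degree_gt0 ab.
have adjH_le a : adj_sum H z a <=
    \sum_(b | adj G a b && adj H a b) f (degree G a)%:R (degree G b)%:R * z b.
  rewrite /adj_sum (eq_bigl (fun b => adj G a b && adj H a b)) => [|b]; last first.
    by have [/(adj_sub HG) ->|] := boolP (adj H a b); rewrite ?andbF.
  apply: ler_sum => b /andP[_ ab]; rewrite ler_pM2r // weight_le ?degree_sub ?(degree_gt0 ab) //.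
  by rewrite adjC in ab; exact: degree_gt0 ab.
have split_sum a : adj_sum G z a =
    \sum_(b | adj G a b && adj H a b) f (degree G a)%:R (degree G b)%:R * z b +
    \sum_(b | adj G a b && ~~ adj H a b) f (degree G a)%:R (degree G b)%:R * z b.
  exact: bigID.
have le_sum a : adj_sum H z a <= adj_sum G z a.
  apply: le_trans (adjH_le a) _; rewrite split_sum lerDl sumr_ge0 // => b /andP[/term_ge0/ltW //].
split => // [a _|]; first by rewrite -zG le_sum.
have [y yG yH] : exists2 y, y \in vertices G & y \notin vertices H.
  by apply/subsetPn; apply: contra VHG => GH; rewrite eqEsubset VHs.
have [a [b [aH bH ab]]] := connect_crossing (connG x y (subsetP VHs x xH) yG) xH yH.
exists a => //; rewrite -zG (le_lt_trans (adjH_le a)) // split_sum ltrDl (bigD1 b) /=.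
  by rewrite ltr_wpDr ?term_ge0 // sumr_ge0 // => i /andP[/andP[/term_ge0/ltW]].
by rewrite ab; apply: contra bH; rewrite adjC; exact: adj_vertex.
Qed.

End WeightedAdjacency.

Theorem theorem5p1 (R : realType) (f : R -> R -> R)
    (f_gt0 : forall x y : R, 0 < x -> 0 < y -> 0 < f x y)
    (f_sym : forall x y : R, 0 < x -> 0 < y -> f x y = f y x)
    (f_incr : forall x1 x2 y : R, 0 < x1 -> 0 < y -> x1 <= x2 -> f x1 y <= f x2 y)
    (c n : nat) (hc : (1 <= c)%N)
    (G : sgraph 'I_n) (hG : cyclic_graphs c G)
    (hmin : forall H : sgraph 'I_n, cyclic_graphs c H -> rho f G <= rho f H) :
  unique (is_base c G) G.
Proof.
have [VG cG] := hG.
have baseG : is_base c G G.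
  (* A c-cyclic subgraph with all the vertices of [G] is [G] itself, so [K] may be assumed to miss a
     vertex. *)
  split => // K KG cK; apply: (cyclic_spanning_eq KG cG cK); apply/eqP/negPn/negP => VK.
  have [H [HK cH deg2H]] := cyclic_core hc cK.
  have HG : subgraph H G.
    by case: HK KG => [VHK EHK] [VKG EKG]; split; [apply: subset_trans VKG|apply: subset_trans EKG].
  (* If [H] had all the vertices of [G], so would [K], which contains [H]. *)
  have VH : vertices H != vertices G.
    apply: contraNneq VK => VHG; rewrite eqEsubset -{2}VHG; apply/andP; split; first by case: KG.
    by case: HK.
  have [y y_gt0 yG] := perron_vector f_gt0 f_sym cG.1 VG.
  have [H0 _] := cH.1.
  have zH := subgraph_supersolution f_gt0 f_sym f_incr HG VH H0 cG.1 y_gt0 yG.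
  have [L [z [VL cL [z_gt0 z_le [s _ z_lt]]]]] :=
    spanning_supersolution f_gt0 f_sym f_incr cH deg2H zH.
  (* The competitor [L] has order [n] and [rho f L < rho f G], against the minimality of [G]. *)
  have := hmin L (conj VL cL); rewrite leNgt => /negP; apply.
  apply: (rho_lt f_gt0 f_sym cL.1 VL z_gt0) => [i|]; last by exists s.
  by apply: z_le; rewrite VL inE.
(* Any base is a c-cyclic subgraph of [G], so the minimality just proved identifies it with [G]. *)
by split => // K [KG cK _]; case: baseG => _ _ /(_ K KG cK).
Qed.
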